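(* Let $\mathcal V$ be a Euclidean Jordan algebra and let $\Theta : \mathcal V \to \mathbb{R}$ be a function. Let $F : \mathcal V \to \mathbb{R}$ be a weakly spectral function and let $\mathcal{E} \subseteq \mathcal V$ be a weakly spectral set. Let $a \in \mathcal V$ be such that $\Theta$ is Clarke regular at $a$. Suppose further that $a$ is a local minimizer of the map $x \in \mathcal{E} \mapsto \Theta(x) + F(x)$ (i.e. $a\in\mathcal E$ and $\Theta(a)+F(a)\le\Theta(x)+F(x)$ for all $x\in\mathcal E$ in some neighborhood of $a$). Then $a$ operator commutes with some element of the Clarke subdifferential $\partial^\circ\Theta(a)$.
   Context: A Euclidean Jordan algebra is a finite dimensional real inner product space $(\mathcal V,\langle\cdot,\cdot\rangle)$ with a bilinear product $\circ:\mathcal V\times\mathcal V\to\mathcal V$ that is commutative, satisfies the Jordan identity $x^2\circ(x\circ y)=x\circ(x^2\circ y)$ (with $x^2=x\circ x$), satisfies $\langle x\circ y,z\rangle=\langle y,x\circ z\rangle$ for all $x,y,z$, and (standing assumption) has a unit element $e$. For $a\in\mathcal V$, $L_a:\mathcal V\to\mathcal V$ is $L_ax=a\circ x$. Elements $a,b\in\mathcal V$ operator commute if $L_aL_b=L_bL_a$. $\operatorname{Aut}(\mathcal V)$ is the set of invertible linear maps $X:\mathcal V\to\mathcal V$ with $X(a\circ b)=Xa\circ Xb$ for all $a,b\in\mathcal V$. A set $\mathcal E\subseteq\mathcal V$ is weakly spectral if $x\in\mathcal E$ implies $Xx\in\mathcal E$ for all $X\in\operatorname{Aut}(\mathcal V)$.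 A function $F:\mathcal V\to\mathbb R$ is weakly spectral if $F(Xx)=F(x)$ for all $x\in\mathcal V$, $X\in\operatorname{Aut}(\mathcal V)$. For $f:\mathcal V\to\mathbb R$ locally Lipschitz around $\bar x$, the Clarke generalized directional derivative is $f^\circ(\bar x;d)=\limsup_{x\to\bar x,\ t\downarrow0}\frac{f(x+td)-f(x)}{t}$, and the Clarke subdifferential is $\partial^\circ f(\bar x)=\{v\in\mathcal V: f^\circ(\bar x;d)\ge\langle v,d\rangle\ \forall d\in\mathcal V\}$. The function $f$ is Clarke regular at $\bar x\in\mathcal V$ if it is locally Lipschitz around $\bar x$ and, for every $d\in\mathcal V$, the ordinary directional derivative $f'(\bar x;d)=\lim_{t\downarrow0}\frac{f(\bar x+td)-f(\bar x)}{t}$ exists and equals $f^\circ(\bar x;d)$. *)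

(* Defs.v *)
From HB Require Import structures.
From mathcomp Require Import all_boot all_order all_algebra.
From mathcomp Require Import all_classical all_reals all_analysis.

Set Implicit Arguments.
Unset Strict Implicit.
Unset Printing Implicit Defensive.

Import Order.TTheory GRing.Theory Num.Theory.
Import numFieldNormedType.Exports.

Local Open Scope classical_set_scope.
Local Open Scope ring_scope.

(* {dot V for idfun} is a symmetric positive definite bilinear form, i.e. a    *)
(* real inner product. By norm_inner the norm of V, hence its topology, is the *)
(* one induced by inner; finite dimension comes from Vector.                   *)
HB.mixin Record NormedModule_Vector_isEuclideanJordanAlgebra (R : realType) V
    & NormedModule R V & Vector R V := {
  inner : {dot V for idfun} ;
  norm_inner : forall x : V, `|x| = Num.sqrt (inner x x) ;
  jmul : {bilinear V -> V -> V} ;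
  junit : V ;
  jmulC : commutative jmul ;
  jordan_identity : forall x y : V,
    jmul (jmul x x) (jmul x y) = jmul x (jmul (jmul x x) y) ;
  inner_jmul : forall x y z : V, inner (jmul x y) z = inner y (jmul x z) ;
  jmul1x : left_id junit jmul
}.

#[short(type="euclideanJordanAlgebraType")]
HB.structure Definition EuclideanJordanAlgebra (R : realType) :=
  {V of NormedModule R V & Vector R V
   & NormedModule_Vector_isEuclideanJordanAlgebra R V}.

Section JordanAlgebra.
Context {R : realType} {V : euclideanJordanAlgebraType R}.

Definition Lop (a : V) : V -> V := fun x => jmul a x.

Definition operator_commute (a b : V) : Prop :=
  Lop a \o Lop b = Lop b \o Lop a.

Definition jordan_aut (X : {linear V -> V}) : Prop :=
  bijective X /\ forall a b : V, X (jmul a b) = jmul (X a) (X b).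

Definition weakly_spectral_set (E : set V) : Prop :=
  forall x : V, E x -> forall X : {linear V -> V}, jordan_aut X -> E (X x).

Definition weakly_spectral_fun (F : V -> R) : Prop :=
  forall (x : V) (X : {linear V -> V}), jordan_aut X -> F (X x) = F x.

(* The limsup as (y, t) -> (x, 0) with 0 < t and y unrestricted; it is taken  *)
(* in \bar R, and is finite when f is locally Lipschitz around x.             *)
Definition clarke_derivative (f : V -> R) (x d : V) : \bar R :=
  limf_esup (fun p : V * R => ((f (p.1 + p.2 *: d) - f p.1) / p.2)%:E)
            (filter_prod (nbhs x) (0 : R)^'+).

Definition clarke_subdifferential (f : V -> R) (x : V) : set V :=
  [set v | forall d : V, ((inner v d)%:E <= clarke_derivative f x d)%E].

Definition locally_lipschitz_at (f : V -> R) (x : V) : Prop :=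
  exists2 U : set V, nbhs x U & [lipschitz f y | y in U].

Definition clarke_regular (f : V -> R) (x : V) : Prop :=
  locally_lipschitz_at f x /\
  forall d : V, exists2 l : R,
    (f (x + t *: d) - f x) / t @[t --> 0^'+] --> l &
    l%:E = clarke_derivative f x d.

Definition local_minimizer (E : set V) (g : V -> R) (a : V) : Prop :=
  E a /\ \forall x \near a, E x -> g a <= g x.

End JordanAlgebra.

(* Main.v *)
Require Import Defs.
From HB Require Import structures.
From mathcomp Require Import all_boot all_order all_algebra.
From mathcomp Require Import all_classical all_reals all_analysis.
From mathcomp Require Import ring lra.

(** The tangent vectors at [a] of the orbit of [a] under the automorphism group
    include [D a] for every derivation [D], because [exp (t D)] is an
    automorphism.  Minimality of [a] along these orbits, on which [F] is
    constant, makes the directional derivative of [Theta] at [a] nonnegative on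
    the subspace of all the [D a].  By regularity this derivative is the
    sublinear Clarke derivative, so Hahn-Banach yields a subgradient [v]
    orthogonal to all the [D a].  Taking for [D] the commutators [L_u L_w - L_w
    L_u], which are derivations by the polarized Jordan identity, associativity
    of the inner product turns this orthogonality into [L_a L_v = L_v L_a]. *)

Set Implicit Arguments.
Unset Strict Implicit.
Unset Printing Implicit Defensive.

Import Order.TTheory GRing.Theory Num.Theory.
Import numFieldNormedType.Exports.

Local Open Scope classical_set_scope.
Local Open Scope ring_scope.

(** * Inner product, Riesz representation and boundedness of linear and bilinear maps *)

Section InnerProduct.
Context {R : realType} {V : euclideanJordanAlgebraType R}.
Implicit Types x y z : V.

Lemma innerC x y : inner x y = inner y x :> R.
Proof. by rewrite hermC /= expr0 mul1r. Qed.

Lemma innerDl x y z : inner (x + y) z = inner x z + inner y z :> R.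
Proof. exact: linearDl. Qed.

Lemma innerBl x y z : inner (x - y) z = inner x z - inner y z :> R.
Proof. exact: linearBl. Qed.

Lemma innerZl (k : R) x y : inner (k *: x) y = k * inner x y :> R.
Proof. exact: linearZl_LR. Qed.

Lemma inner0l x : inner 0 x = 0 :> R.
Proof. exact: linear0l. Qed.

Lemma innerDr x y z : inner x (y + z) = inner x y + inner x z :> R.
Proof. exact: linearDr. Qed.

Lemma innerBr x y z : inner x (y - z) = inner x y - inner x z :> R.
Proof. exact: linearBr. Qed.

Lemma innerZr (k : R) x y : inner x (k *: y) = k * inner x y :> R.
Proof. exact: linearZr_LR. Qed.

Lemma inner_sumr I (r : seq I) (P : pred I) (y : I -> V) x :
  inner x (\sum_(i <- r | P i) y i) = \sum_(i <- r | P i) inner x (y i) :> R.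
Proof. exact: linear_sumr. Qed.

Lemma jmulDl x y z : jmul (x + y) z = jmul x z + jmul y z.
Proof. exact: linearDl. Qed.

Lemma jmulZl (k : R) x y : jmul (k *: x) y = k *: jmul x y.
Proof. exact: linearZl_LR. Qed.

Lemma jmulDr x y z : jmul x (y + z) = jmul x y + jmul x z.
Proof. exact: linearDr. Qed.

Lemma jmulBr x y z : jmul x (y - z) = jmul x y - jmul x z.
Proof. exact: linearBr. Qed.

Lemma jmulZr (k : R) x y : jmul x (k *: y) = k *: jmul x y.
Proof. exact: linearZr_LR. Qed.

Lemma jmul_suml I (r : seq I) (P : pred I) (x : I -> V) y :
  jmul (\sum_(i <- r | P i) x i) y = \sum_(i <- r | P i) jmul (x i) y.
Proof. exact: linear_sumlz. Qed.

Lemma jmul_sumr I (r : seq I) (P : pred I) (y : I -> V) x :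
  jmul x (\sum_(i <- r | P i) y i) = \sum_(i <- r | P i) jmul x (y i).
Proof. exact: linear_sumr. Qed.

Lemma inner_inj x y : (forall z, inner x z = inner y z) -> x = y.
Proof.
move=> xy; apply/eqP; rewrite -subr_eq0 -normr_eq0 norm_inner.
by rewrite innerBl (xy (x - y)) subrr sqrtr0.
Qed.

Lemma inner_norm x : inner x x = `|x| ^+ 2 :> R.
Proof.
rewrite norm_inner sqr_sqrtr//.
have [->|x0] := eqVneq x 0; first by rewrite inner0l.
by rewrite ltW// neq0_dnorm_gt0.
Qed.

(** Cauchy-Schwarz is read off from the triangle inequality, by squaring it and expanding
    [inner (u + v) (u + v)]; replacing [x] by [- x] gives the absolute value. *)
Lemma ler_inner_norm x y : `|inner x y| <= `|x| * `|y|.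
Proof.
have le_inner (u v : V) : inner u v <= `|u| * `|v|.
  have : `|u + v| ^+ 2 <= (`|u| + `|v|) ^+ 2.

    by rewrite lerXn2r ?nnegrE ?addr_ge0 ?ler_normD.
  rewrite -inner_norm innerDl !innerDr !inner_norm (innerC v u) sqrrD; lra.
rewrite ler_norml le_inner andbT -[X in X * _]normrN lerNl.
by rewrite -mulN1r -innerZl scaleN1r le_inner.
Qed.

(** The map sending [v] to its inner products with a basis is injective, hence onto by a dimension
    count. A preimage of the row of values of [f] on the basis represents [f]. *)
Lemma riesz (f : V -> R) : scalar f -> exists v : V, f = inner v.
Proof.
move=> f_lin.
pose b := vbasis {:V}.
pose phi (v : V) : 'rV[R]_(\dim {:V}) := \row_i inner v b`_i.
have phi_lin : linear phi.
  by move=> k u v; apply/rowP => i; rewrite !mxE innerDl innerZl.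
pose phiL : {linear V -> 'rV[R]_(\dim {:V})} :=
  HB.pack phi (GRing.isLinear.Build _ _ _ _ phi phi_lin).
have fS (c : 'I_(\dim {:V}) -> R) (e : 'I_(\dim {:V}) -> V) :
    f (\sum_i c i *: e i) = \sum_i c i * f (e i).
  have f0 : f 0 = 0 by have := f_lin (-1) 0 0; rewrite scaler0 addr0; lra.
  apply: (big_rec2 (fun u r => f u = r)) => // i r u _ <-.
  exact: f_lin.
have bE (x : V) : x = \sum_i coord b i x *: b`_i.
  by apply: coord_vbasis; rewrite memvf.
have lker_phi : lker (linfun phiL) == 0%VS.
  apply/lker0P => u v; rewrite !lfunE /= => uv.
  apply: inner_inj => z; rewrite (bE z) !inner_sumr; apply: eq_bigr => i _.
  by rewrite !innerZr; have /rowP/(_ i) := uv; rewrite !mxE => ->.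
have /eqP limg_phi : limg (linfun phiL) == fullv.
  rewrite eqEdim subvf /= limg_dim_eq ?(eqP lker_phi) ?capv0//.
  by rewrite !dimvf /dim /= mul1n.
have : \row_i f b`_i \in limg (linfun phiL) by rewrite limg_phi memvf.
move=> /memv_imgP[v _]; rewrite lfunE /= => /rowP vf.
exists v; apply/funext => x.
rewrite (bE x) fS inner_sumr; apply: eq_bigr => i _.
by rewrite innerZr; have := vf i; rewrite !mxE => ->.
Qed.

Lemma scalar_bounded (f : V -> R) :
  scalar f -> exists2 c, 0 <= c & forall x, `|f x| <= c * `|x|.
Proof. by move=> /riesz[v ->]; exists `|v| => // x; exact: ler_inner_norm. Qed.

Lemma coord_bounded : exists2 c, 0 <= c &
  forall i (x : V), `|coord (vbasis {:V}) i x| <= c * `|x|.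
Proof.
have cP i : exists c, 0 <= c /\
    forall x : V, `|coord (vbasis {:V}) i x| <= c * `|x|.
  by have [|c c0 cP] := @scalar_bounded (coord (vbasis {:V}) i);
    [exact: linearP|exists c].
have [c {}cP] := choice cP.
exists (\sum_i c i) => [|i x]; first by rewrite sumr_ge0// => i _; case: (cP i).
apply: le_trans (_ : c i * `|x| <= _); first by case: (cP i) => _; apply.
rewrite ler_wpM2r// (bigD1 i)//= lerDl sumr_ge0// => j _; by case: (cP j).
Qed.

Lemma linear_bounded (A : V -> V) :
  linear A -> exists2 c, 0 <= c & forall x, `|A x| <= c * `|x|.
Proof.
move=> A_lin; pose AL : {linear V -> V} :=
  HB.pack A (GRing.isLinear.Build _ _ _ _ A A_lin).
have [c c0 cP] := coord_bounded.
exists (\sum_(i < \dim {:V}) c * `|A (vbasis {:V})`_i|) => [|x].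
  by rewrite sumr_ge0// => i _; rewrite mulr_ge0.
rewrite {1}(coord_vbasis (memvf x)) -[A]/(AL : V -> V) linear_sum.
rewrite mulr_suml (le_trans (ler_norm_sum _ _ _))// ler_sum// => i _.
by rewrite linearZ /= normrZ mulrAC ler_wpM2r.
Qed.

Lemma jmul_bounded : exists2 c, 0 <= c &
  forall x y : V, `|jmul x y| <= c * `|x| * `|y|.
Proof.
have [c c0 cP] := coord_bounded.
have dP i : exists d, 0 <= d /\
    forall y : V, `|jmul (vbasis {:V})`_i y| <= d * `|y|.
  have [|d d0 dP] := @linear_bounded (jmul (vbasis {:V})`_i); last by exists d.
  exact: linearP.
have [d {}dP] := choice dP.
exists (\sum_(i < \dim {:V}) c * d i) => [|x y].
  by rewrite sumr_ge0// => i _; rewrite mulr_ge0//; case: (dP i).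
rewrite {1}(coord_vbasis (memvf x)) jmul_suml.
rewrite !mulr_suml (le_trans (ler_norm_sum _ _ _))// ler_sum// => i _.
rewrite jmulZl normrZ (mulrAC c) -[leRHS]mulrA.
by apply: ler_pM => //; case: (dP i).
Qed.

End InnerProduct.

(** * Derivations and commutators of multiplication operators *)

Section Derivations.
Context {R : realType} {V : euclideanJordanAlgebraType R}.
Implicit Types a u v w x y z : V.

Definition derivation (D : V -> V) : Prop :=
  linear D /\ forall x y, D (jmul x y) = jmul (D x) y + jmul x (D y).

Definition inner_derivation u w : V -> V :=
  fun x => jmul u (jmul w x) - jmul w (jmul u x).

(** Inclusion-exclusion over the diagonal values at [x + y + z], the pairwise sums and the single
    vectors leaves the sum of [g] over all permutations, which is twice the cyclic sum. *)
Lemma symmetric_trilinear_polarization (g : V -> V -> V -> R) x y z :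
  (forall a b c d, g (a + b) c d = g a c d + g b c d) ->
  (forall a b c d, g a b (c + d) = g a b c + g a b d) ->
  (forall a b c, g a b c = g b a c) -> (forall a, g a a a = 0) ->
  g x y z + g y z x + g z x y = 0.
Proof.
move=> gDl gDr gC g0.
have gDm a b c d : g a (b + c) d = g a b d + g a c d.
  by rewrite gC gDl !(gC a).
have := g0 (x + y + z); have := g0 (x + y); have := g0 (y + z).
have := g0 (x + z); have := g0 x; have := g0 y; have := g0 z.
rewrite !(gDl, gDm, gDr) !(gC y x) !(gC z x) !(gC z y); lra.
Qed.

(* Obtained by polarizing the Jordan identity in [x]. The left-hand side is   *)
(* symmetric in the four variables, hence so is the right-hand side.          *)
Lemma jordan_identity_polarized x y z w :
  jmul (jmul x z) (jmul w y) + jmul (jmul z w) (jmul x y) +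
    jmul (jmul w x) (jmul z y) =
  jmul w (jmul (jmul x z) y) + jmul x (jmul (jmul z w) y) +
    jmul z (jmul (jmul w x) y).
Proof.
pose f a b c := jmul (jmul a b) (jmul c y) - jmul c (jmul (jmul a b) y).
suff f0 : f x z w + f z w x + f w x z = 0.
  apply: subr0_eq; rewrite -[RHS]f0 /f 2!opprD.
  by rewrite addrACA; congr (_ + _); exact: addrACA.
apply: inner_inj => t.
rewrite inner0l (innerDl (f x z w + f z w x)) (innerDl (f x z w)).
apply: (@symmetric_trilinear_polarization (fun a b c => inner (f a b c) t)).
- by move=> a b c d; rewrite -innerDl /f !(jmulDl, jmulDr) opprD addrACA.
- by move=> a b c d; rewrite -innerDl /f !(jmulDl, jmulDr) opprD addrACA.
- by move=> a b c; rewrite /f (jmulC a b).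
- by move=> a; rewrite /f jordan_identity subrr inner0l.
Qed.

(** Exchanging [u] and [w] in the polarized identity permutes the terms of its left-hand side.
    Equating the two right-hand sides gives the Leibniz rule. *)
Lemma inner_derivationP u w : derivation (inner_derivation u w).
Proof.
split=> [k x y|x y].
  by rewrite /inner_derivation !(jmulDr, jmulZr) scalerBr opprD addrACA.
have Hu := jordan_identity_polarized y u w x.
have Hw := jordan_identity_polarized y w u x.
have {}Hu : jmul x (jmul u (jmul w y)) + jmul y (jmul u (jmul w x)) +
    jmul w (jmul u (jmul x y)) =
    jmul x (jmul w (jmul u y)) + jmul y (jmul w (jmul u x)) +
    jmul u (jmul w (jmul x y)).
  transitivity (jmul (jmul y w) (jmul x u) + jmul (jmul w x) (jmul y u) +
    jmul (jmul x y) (jmul w u)); first by rewrite Hu !(jmulC _ u) (jmulC y w).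
  transitivity (jmul (jmul y u) (jmul x w) + jmul (jmul u x) (jmul y w) +
    jmul (jmul x y) (jmul u w)); last by rewrite Hw !(jmulC _ w) (jmulC y u).
  rewrite (jmulC u w) (jmulC u x) (jmulC w x); congr (_ + _).
  by rewrite addrC; congr (_ + _); exact: jmulC.
(* Pairing with an arbitrary [t] turns the vector identity into one between reals, which linear
   arithmetic settles. *)
apply: inner_inj => t; have {Hu Hw} := congr1 (fun z => inner z t) Hu.
rewrite /inner_derivation !(jmulC _ y) !jmulBr !(innerBl, innerDl); lra.
Qed.

End Derivations.

(** * Truncated Cauchy products *)

Section CauchyProduct.

(** The antidiagonals [m < n] fill the triangle [j + k < n]; removing it from the square leaves the
    pairs with [n <= j + k]. *)
Lemma cauchy_product_tail (M : zmodType) (f : nat -> nat -> M) n :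
  \sum_(0 <= j < n) \sum_(0 <= k < n) f j k -
    \sum_(0 <= m < n) \sum_(0 <= j < m.+1) f j (m - j)%N =
  \sum_(0 <= j < n) \sum_(n - j <= k < n) f j k.
Proof.
suff -> : \sum_(0 <= m < n) \sum_(0 <= j < m.+1) f j (m - j)%N =
    \sum_(0 <= j < n) \sum_(0 <= k < n - j) f j k.
  rewrite -sumrB; apply: eq_bigr => j _.
  by rewrite (big_cat_nat (n := n - j)) ?leq_subr//= addrAC subrr add0r.
transitivity (\sum_(0 <= m < n) \sum_(0 <= j < n | (j <= m)%N) f j (m - j)%N).
  rewrite !big_nat; apply: eq_bigr => m /andP[_ mn].
  by rewrite (big_nat_widen _ _ n).
rewrite (exchange_big_dep_nat predT)//=; apply: eq_bigr => j _.
transitivity (\sum_(j <= m < n) f j (m - j)%N).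
  by rewrite [RHS](big_nat_widenl j 0).
rewrite -{1}[j]add0n big_addn.
by apply: eq_bigr => k _; rewrite addnK.
Qed.

End CauchyProduct.

(** * Exponentials of linear maps, and automorphisms generated by derivations *)

Section Exponential.
Context {R : realType} {V : euclideanJordanAlgebraType R}.
Implicit Types (x y : V) (A : {linear V -> V}) (c : R).

(** The comparison test is applied to each coordinate in a basis, and the coordinate limits are
    recombined. *)
Lemma series_cvg_bounded (u : V^nat) (b : R^nat) :
  (forall n, `|u n| <= b n) -> cvgn (series b) -> cvgn (series u).
Proof.
move=> ub b_cvg.
have [c c0 cP] := @coord_bounded R V.
pose s i n := coord (vbasis {:V}) i (series u n).
have s_cvg i : cvgn (s i).
  have -> : s i = series (fun n => coord (vbasis {:V}) i (u n)).
    by apply/funext => n; rewrite /s !seriesEnat linear_sum.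
  apply: normed_cvg; apply: (@series_le_cvg _ _ (c \*: b)) => [n|n|n|].
  - exact: normr_ge0.
  - by rewrite mulr_ge0// (le_trans _ (ub n)).
  - by rewrite (le_trans (cP _ _))// ler_wpM2l.
  - exact: is_cvg_seriesZ.
suff -> : series u = fun n => \sum_(i < \dim {:V}) s i n *: (vbasis {:V})`_i.
  apply/cvg_ex; exists (\sum_(i < \dim {:V}) limn (s i) *: (vbasis {:V})`_i).
  apply: (cvg_big (op := +%R)) => [|i _]; first exact: add_continuous.
  exact: cvgZr_tmp (s_cvg i).
by apply/funext => n; exact/coord_vbasis/memvf.
Qed.

Definition exp_term A x : V^nat := fun k => (k`!%:R)^-1 *: iter k A x.

Definition exp_map A x : V := limn (series (exp_term A x)).

Section Bounded.
Variables (A : {linear V -> V}) (c : R).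
Hypotheses (c0 : 0 <= c) (Ac : forall x, `|A x| <= c * `|x|).

Lemma exp_term_le x k : `|exp_term A x k| <= exp_coeff c k * `|x|.
Proof.
rewrite /exp_term normrZ /exp_coeff /= ger0_norm ?invr_ge0//.
rewrite mulrC mulrAC ler_wpM2r ?invr_ge0//.
elim: k => [|k IH]; first by rewrite expr0 mul1r.
by rewrite iterS (le_trans (Ac _))// exprS -mulrA ler_wpM2l.
Qed.

Lemma exp_map_cvg x : series (exp_term A x) @ \oo --> exp_map A x.
Proof.
apply: series_cvg_bounded (exp_term_le x) _.
have -> : series (fun n => exp_coeff c n * `|x|) =
    `|x| \*: series (exp_coeff c).
  apply/funext => n; rewrite !seriesEnat /= scaler_sumr.
  by apply: eq_bigr => i _; rewrite mulrC.
by apply: is_cvgZl_tmp; exact: is_cvg_series_exp_coeff.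
Qed.

Lemma exp_map_linear : linear (exp_map A).
Proof.
move=> k x y; apply: cvg_lim => //.
have -> : series (exp_term A (k *: x + y)) =
    k \*: series (exp_term A x) \+ series (exp_term A y).
  apply/funext => n; rewrite /= !seriesEnat /= scaler_sumr -big_split /=.
  apply: eq_bigr => i _; rewrite /exp_term scalerA (mulrC k) -scalerA -scalerDr.
  congr (_ *: _).
  by elim: i => // i IH; rewrite !iterS IH linearP.
apply: cvgD; last exact: exp_map_cvg.
by apply: cvgZl_tmp; exact: exp_map_cvg.
Qed.

(** The terms of index at least 2 are dominated, one by one, by those of the scalar series for
    [expR c]. *)
Lemma exp_map_approx x :
  `|exp_map A x - x - A x| <= (expR c - 1 - c) * `|x|.
Proof.
have lhs : `|series (exp_term A x) n - x - A x| @[n --> \oo] -->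
    `|exp_map A x - x - A x|.
  apply: cvg_norm; apply: cvgB; last exact: cvg_cst.
  by apply: cvgB; [exact: exp_map_cvg|exact: cvg_cst].
have rhs : (series (exp_coeff c) n - 1 - c) * `|x| @[n --> \oo] -->
    (expR c - 1 - c) * `|x|.
  apply: cvgMr_tmp; apply: cvgB; last exact: cvg_cst.
  by apply: cvgB; [exact: is_cvg_series_exp_coeff|exact: cvg_cst].
apply: (ler_cvg_to lhs rhs); near=> n.
have n2 : (2 <= n)%N by near: n; exact: nbhs_infty_ge.
have split2 (M : zmodType) (u : M^nat) :
    series u n - u 0%N - u 1%N = \sum_(2 <= i < n) u i.
  rewrite seriesEnat /= big_ltn ?(ltn_trans _ n2)// big_ltn//.
  by rewrite [u 0%N + _]addrC addrK [u 1%N + _]addrC addrK.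
have e0 : exp_coeff c 0%N = 1 by rewrite /exp_coeff /= expr0 invr1 mulr1.
have e1 : exp_coeff c 1%N = c by rewrite /exp_coeff /= expr1 invr1 mulr1.
have t0 : exp_term A x 0%N = x by rewrite /exp_term /= invr1 scale1r.
have t1 : exp_term A x 1%N = A x by rewrite /exp_term /= invr1 scale1r.
have := split2 _ (exp_term A x); have := split2 _ (exp_coeff c).
rewrite e0 e1 t0 t1 => -> ->.
rewrite mulr_suml (le_trans (ler_norm_sum _ _ _))// ler_sum// => i _.
exact: exp_term_le.
Unshelve. all: by end_near. Qed.

End Bounded.

Lemma exp_termS A x k :
  A (exp_term A x k) = k.+1%:R *: exp_term A x k.+1.
Proof.
by rewrite /exp_term linearZ /= scalerA factS natrM invfM mulVKf.
Qed.

(** This is the binomial theorem divided by [m!]. It makes the scalar majorant of the Cauchy product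
    error computable: its limit is [expR c * expR c - expR (c + c)]. *)
Lemma exp_coeffD c m :
  exp_coeff (c + c) m =
  \sum_(0 <= j < m.+1) exp_coeff c j * exp_coeff c (m - j)%N.
Proof.
rewrite big_mkord /exp_coeff /= exprDn mulr_suml; apply: eq_bigr => i _.
have im : (i <= m)%N by rewrite -ltnS.
rewrite -(bin_fact im) !natrM !invfM -mulr_natl.
rewrite mulrACA divff ?pnatr_eq0 -?lt0n ?bin_gt0// mul1r.
by rewrite [c ^+ (m - i) * c ^+ i]mulrC mulrACA.
Qed.

Lemma jmul_cvg (u v : V^nat) x y : u @ \oo --> x -> v @ \oo --> y ->
  jmul (u n) (v n) @[n --> \oo] --> jmul x y.
Proof.
move=> ux vy; have [K K0 KP] := @jmul_bounded R V.
suff : `|jmul (u n) (v n) - jmul x y| @[n --> \oo] --> (0 : R).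
  by move=> /norm_cvg0/subr_cvg0.
apply: (squeeze_cvgr (f := fun=> 0)
  (h := fun n => K * `|u n| * `|v n - y| + K * `|u n - x| * `|y|)).
- near=> n; rewrite normr_ge0 /=.
  have -> : jmul (u n) (v n) - jmul x y =
      jmul (u n) (v n - y) + jmul (u n - x) y.
    by rewrite jmulBr (jmulC (u n - x)) jmulBr !(jmulC y) addrA subrK.
  by rewrite (le_trans (ler_normD _ _))// lerD.
- exact: cvg_cst.
- rewrite -[X in _ --> X]addr0; apply: cvgD.
    rewrite -(mulr0 (K * `|x|)); apply: cvgM.
      by apply: cvgMl_tmp; exact: cvg_norm.
    by apply/norm_cvg0P/subr_cvg0.
  rewrite -(mul0r `|y|) -[X in X * _](mulr0 K).
  apply: cvgMr_tmp; apply: cvgMl_tmp.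
  by apply/norm_cvg0P/subr_cvg0.
Unshelve. all: by end_near. Qed.

Section ExponentialOfDerivation.
Variables (A : {linear V -> V}) (c : R).
Hypotheses (c0 : 0 <= c) (Ac : forall x, `|A x| <= c * `|x|).
Hypothesis A_jmul : forall x y, A (jmul x y) = jmul (A x) y + jmul x (A y).

(** The iterated Leibniz rule; division by the factorials absorbs the binomial coefficients. *)
Lemma exp_term_jmul x y m : exp_term A (jmul x y) m =
  \sum_(0 <= j < m.+1) jmul (exp_term A x j) (exp_term A y (m - j)%N).
Proof.
elim: m => [|m IH].
  by rewrite big_nat1 subnn /exp_term /= invr1 !scale1r.
apply: (@scalerI _ _ m.+1%:R); first by rewrite pnatr_eq0.
rewrite -exp_termS IH linear_sum scaler_sumr.
pose T i j := jmul (exp_term A x i) (exp_term A y j).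
(* The factor [m.+1] is split as [j + (m.+1 - j)]. The first share comes from [A] acting on the left
   factor and vanishes at [j = 0]; the second comes from the right factor and vanishes at
   [j = m.+1]. *)
transitivity (\sum_(0 <= j < m.+2) (j%:R *: T j (m.+1 - j)%N +
    (m.+1 - j)%:R *: T j (m.+1 - j)%N)); last first.
  rewrite !big_nat; apply: eq_bigr => j /andP[_ jm].
  by rewrite -scalerDl -natrD subnKC.
rewrite [RHS]big_split /= [X in _ = X + _]big_nat_recl// mulr0n scale0r add0r.
rewrite [X in _ + X]big_nat_recr//= subnn mulr0n scale0r addr0 -big_split /=.
rewrite !big_nat; apply: eq_bigr => j /andP[_ jm].
by rewrite A_jmul !exp_termS jmulZl (jmulZr (m - j).+1%:R) subSS subSn.
Qed.

Lemma exp_map_jmul x y :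
  exp_map A (jmul x y) = jmul (exp_map A x) (exp_map A y).
Proof.
have [K K0 KP] := @jmul_bounded R V.
pose S z := series (exp_term A z); pose e := series (exp_coeff c).
(* Both sides are sums over [j, k < n <= j + k], and the scalar one tends to  *)
(* [expR c * expR c - expR (c + c) = 0].                                      *)
have S_le n : `|jmul (S x n) (S y n) - S (jmul x y) n| <=
    K * `|x| * `|y| * (e n * e n - series (exp_coeff (c + c)) n).
  have -> : jmul (S x n) (S y n) = \sum_(0 <= j < n) \sum_(0 <= k < n)
      jmul (exp_term A x j) (exp_term A y k).
    rewrite /S !seriesEnat /= jmul_suml; apply: eq_bigr => j _.
    by rewrite jmul_sumr.
  have -> : S (jmul x y) n = \sum_(0 <= m < n) \sum_(0 <= j < m.+1)
      jmul (exp_term A x j) (exp_term A y (m - j)%N).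
    by rewrite /S seriesEnat /=; apply: eq_bigr => m _; rewrite exp_term_jmul.
  have -> : e n * e n = \sum_(0 <= j < n) \sum_(0 <= k < n)
      exp_coeff c j * exp_coeff c k.
    rewrite /e !seriesEnat /= mulr_suml; apply: eq_bigr => j _.
    by rewrite mulr_sumr.
  have -> : series (exp_coeff (c + c)) n = \sum_(0 <= m < n)
      \sum_(0 <= j < m.+1) exp_coeff c j * exp_coeff c (m - j)%N.
    by rewrite seriesEnat /=; apply: eq_bigr => m _; rewrite exp_coeffD.
  rewrite (cauchy_product_tail
    (fun j k => jmul (exp_term A x j) (exp_term A y k))).
  rewrite (cauchy_product_tail (fun j k => exp_coeff c j * exp_coeff c k)).
  rewrite mulr_sumr (le_trans (ler_norm_sum _ _ _))// ler_sum// => j _.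
  rewrite mulr_sumr (le_trans (ler_norm_sum _ _ _))// ler_sum// => k _.
  rewrite (le_trans (KP _ _))//.
  have -> : K * `|x| * `|y| * (exp_coeff c j * exp_coeff c k) =
    K * (exp_coeff c j * `|x|) * (exp_coeff c k * `|y|) by ring.
  by rewrite ler_pM ?mulr_ge0// ?ler_wpM2l// exp_term_le.
apply/esym/subr0_eq/eqP; rewrite -normr_le0.
have lhs : `|jmul (S x n) (S y n) - S (jmul x y) n| @[n --> \oo] -->
    `|jmul (exp_map A x) (exp_map A y) - exp_map A (jmul x y)|.
  apply: cvg_norm; apply: cvgB; last exact: exp_map_cvg Ac _.
  by apply: jmul_cvg; exact: exp_map_cvg Ac _.
have rhs : K * `|x| * `|y| * (e n * e n - series (exp_coeff (c + c)) n)
    @[n --> \oo] --> (0 : R).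
  rewrite -(mulr0 (K * `|x| * `|y|)); apply: cvgMl_tmp.
  rewrite -(subrr (expR (c + c))) {1}expRD; apply: cvgB.
    by apply: cvgM; exact: is_cvg_series_exp_coeff.
  exact: is_cvg_series_exp_coeff.
by apply: (ler_cvg_to lhs rhs); near=> n.
Unshelve. all: by end_near. Qed.

End ExponentialOfDerivation.

(** From [1 - c <= expR (- c)] one gets [expR c <= 1 / (1 - c)], so the remainder is at most
    [c ^+ 2 / (1 - c)], where [1 - c] is at least one half. *)
Lemma expR_le_quadratic c : 0 <= c <= 2^-1 -> expR c - 1 - c <= 2 * c ^+ 2.
Proof.
move=> /andP[c0 c2]; have := expR_ge1Dx (- c); have := expRxMexpNx_1 c.
have := expR_gt0 c; rewrite expr2; set e := expR c; set f := expR (- c).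
move=> e0 ef f1; have : e * (1 - c) <= 1 by rewrite -[leRHS]ef ler_pM2l.
nra.
Qed.

Lemma linear_inj_bij A : (forall x, A x = 0 -> x = 0) -> bijective A.
Proof.
move=> A0; have lker_A : lker (linfun A) == 0%VS.
  apply/lker0P => u v; rewrite !lfunE /= => uv.
  by apply: subr0_eq; apply: A0; rewrite linearB uv subrr.
exists ((linfun A)^-1)%VF => x.
- by rewrite -[A x](lfunE A) lker0_lfunK.
- by rewrite -(lfunE A) /= lker0_lfunVK.
Qed.

(** The automorphism [X] is the exponential of [t *: D]; its first-order expansion supplies both the
    quadratic error bound and, for small [t], invertibility. *)
Lemma derivation_flow (D : V -> V) : derivation D -> exists2 K, 0 <= K &
  \forall t \near 0^'+, exists2 X : {linear V -> V}, jordan_aut X &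
    forall x, `|X x - (x + t *: D x)| <= K * t ^+ 2 * `|x|.
Proof.
move=> [D_lin D_jmul]; have [C C0 CP] := linear_bounded D_lin.
exists (2 * C ^+ 2) => [|]; first by rewrite mulr_ge0// sqr_ge0.
near=> t.
have t0 : 0 < t by [].
have tC0 : 0 <= t * C by rewrite mulr_ge0// ltW.
have tC4 : t * C <= 4^-1.
  (* Adding 1 to [C] keeps the denominator positive when [C = 0]. *)
  have tC1 : t <= (4 * (C + 1))^-1.
    by near: t; apply: nbhs_right_le; rewrite invr_gt0; nra.
  have : t * (4 * (C + 1)) <= 1 by rewrite -ler_pdivlMr ?mul1r//; nra.
  nra.
have tD_lin : linear (fun x => t *: D x).
  by move=> k x y; rewrite D_lin scalerDr !scalerA mulrC.
pose A : {linear V -> V} := HB.pack (fun x => t *: D x)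
  (GRing.isLinear.Build _ _ _ _ (fun x => t *: D x) tD_lin).
have AC x : `|A x| <= t * C * `|x|.
  by rewrite /A /= normrZ gtr0_norm// -mulrA ler_wpM2l// ltW.
have A_jmul x y : A (jmul x y) = jmul (A x) y + jmul x (A y).
  by rewrite /A /= D_jmul scalerDr jmulZl jmulZr.
pose X : {linear V -> V} := HB.pack (exp_map A)
  (GRing.isLinear.Build _ _ _ _ (exp_map A) (exp_map_linear tC0 AC)).
have XA x : `|X x - x - A x| <= 2 * (t * C) ^+ 2 * `|x|.
  rewrite (le_trans (exp_map_approx tC0 AC x))// ler_wpM2r//.
  by rewrite expR_le_quadratic// tC0 /=; lra.
exists X; last first.
  move=> x; rewrite opprD addrA (le_trans (XA x))//.
  by rewrite exprMn mulrCA mulrC (mulrC (t ^+ 2)) mulrC.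
split; last exact: exp_map_jmul tC0 AC A_jmul.
(* If [X x = 0], then [|x| <= |x + A x| + |A x| <= (1/8 + 1/4) * |x|], which forces [x = 0]. *)
apply: linear_inj_bij => x X0; have := XA x; rewrite X0 sub0r -opprD normrN.
move=> xA; apply/eqP; rewrite -normr_le0.
have := ler_normB (x + A x) (A x); rewrite addrK => x_le.
have tC8 : 2 * (t * C) ^+ 2 <= 8^-1 by rewrite expr2; nra.
have := ler_wpM2r (normr_ge0 x) tC8; have := ler_wpM2r (normr_ge0 x) tC4.
have := AC x; lra.
Unshelve. all: by end_near. Qed.

End Exponential.

(** * Sublinear functions and a finite-dimensional Hahn-Banach theorem *)

Section HahnBanach.
Context {R : realType}.

Definition sublinear (V : lmodType R) (p : V -> R) : Prop :=
  (forall x y, p (x + y) <= p x + p y) /\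
  (forall t x, 0 <= t -> p (t *: x) = t * p x).

Section InfConvolution.
Context {V : lmodType R}.
Implicit Types (p : V -> R) (P : V -> R -> Prop) (x y : V).

Lemma sublinear0 p : sublinear p -> p 0 = 0.
Proof. by move=> [_ pZ]; rewrite -(scale0r 0) pZ// mul0r. Qed.

(** The witness is the infimum of [p (x + y) - b] over the pairs [(y, b)] of the convex cone [P]; it
    is bounded below by [- p (- x)] because [b <= p y] on [P]. A relation [P] accommodates both a
    ray and a whole subspace. *)
Lemma sublinear_inf p P : sublinear p ->
  P 0 0 ->
  (forall x y b c, P x b -> P y c -> P (x + y) (b + c)) ->
  (forall t x b, 0 <= t -> P x b -> P (t *: x) (t * b)) ->
  (forall x b, P x b -> b <= p x) ->
  exists q, [/\ sublinear q, (forall x, q x <= p x) &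
    forall x b, P x b -> q (- x) <= - b].
Proof.
move=> p_sub P0 PD PZ Pp; have [pD pZ] := p_sub; have p0 := sublinear0 p_sub.
pose B x := [set r | exists y b, P y b /\ r = p (x + y) - b].
have B0 x : B x !=set0 by exists (p (x + 0) - 0); exists 0, 0.
have B_inf x : has_inf (B x).
  split=> //; exists (- p (- x)) => _ [y [b [Pyb ->]]].
  have := pD (- x) (x + y); rewrite addKr => py.
  by have := Pp _ _ Pyb; lra.
pose q x := inf (B x).
have q_le x y b : P y b -> q x <= p (x + y) - b.
  by move=> Pyb; apply: ge_inf; [case: (B_inf x)|exists y, b].
have q_ge x m : (forall y b, P y b -> m <= p (x + y) - b) -> m <= q x.
  by move=> mB; apply: lb_le_inf => // _ [y [b [Pyb ->]]]; exact: mB.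
have qZ_le t x : 0 < t -> q (t *: x) <= t * q x.
  move=> t0; rewrite -ler_pdivrMl//; apply: q_ge => y b Pyb.
  rewrite ler_pdivrMl// mulrBr -(pZ _ _ (ltW t0)) scalerDr.
  by apply: q_le; apply: PZ => //; exact: ltW.
exists q; split=> [|x|x b Pxb].
- split=> [x y|t x].
    rewrite -lerBlDr; apply: (q_ge) => u b Pub.
    suff : q (x + y) - (p (x + u) - b) <= q y by lra.
    apply: (q_ge) => v c Pvc.
    have := q_le (x + y) _ _ (PD _ _ _ _ Pub Pvc).
    by have := pD (x + u) (y + v); rewrite addrACA; lra.
  rewrite le_eqVlt => /predU1P[<-|t0].
    rewrite scale0r mul0r; apply/eqP; rewrite eq_le; apply/andP; split.
      by have := q_le 0 _ _ P0; rewrite addr0 p0 subr0.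
    by apply: q_ge => y b Pyb; rewrite add0r subr_ge0; exact: Pp.
  (* The reverse inequality is [qZ_le] for the factor [t^-1] at [t *: x]. *)
  apply/eqP; rewrite eq_le qZ_le//= -ler_pdivlMl//.
  have tV : 0 < t^-1 by rewrite invr_gt0.
  by have := qZ_le _ (t *: x) tV; rewrite scalerA mulVf ?gt_eqF// scale1r.
- by have := q_le x _ _ P0; rewrite addr0 subr0.
- by have := q_le (- x) _ _ Pxb; rewrite addNr p0 sub0r.
Qed.

End InfConvolution.

Section FiniteDimension.
Context {V : vectType R}.
Implicit Types (p : V -> R) (x y : V).

Lemma sublinear_minorant_odd p (s : seq V) : sublinear p ->
  exists q, [/\ sublinear q, (forall x, q x <= p x) &
    forall x, x \in s -> q (- x) <= - q x].
Proof.
move=> p_sub; elim: s => [|e s [q [q_sub qp qs]]]; first by exists p.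
have [qD qZ] := q_sub.
(* The infimum over [t >= 0] of [q (x + t *: e) - t * q e] is odd at [e].     *)
pose P x b := exists2 t, 0 <= t & x = t *: e /\ b = t * q e.
have [||||r [r_sub rq rP]] := @sublinear_inf _ q P q_sub.
- by exists 0; rewrite // scale0r mul0r.
- move=> _ _ _ _ [t t0 [-> ->]] [u u0 [-> ->]]; exists (t + u).
    exact: addr_ge0.
  by rewrite scalerDl mulrDl.
- move=> u _ _ u0 [t t0 [-> ->]]; exists (u * t); first exact: mulr_ge0.
  by rewrite scalerA mulrA.
- by move=> _ _ [t t0 [-> ->]]; rewrite qZ.
exists r; split=> // [x|x]; first exact: le_trans (rq x) (qp x).
rewrite inE => /predU1P[->|xs].
  have /rP : P e (q e) by exists 1; rewrite ?scale1r ?mul1r.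
  by have := rq e; lra.
(* Oddness at earlier vectors survives: [r (- x) <= q (- x) <= - q x <= - r x]. *)
by have := qs _ xs; have := rq x; have := rq (- x); lra.
Qed.

(** Lowering [p] until it is odd at each basis vector makes it odd everywhere, and an odd sublinear
    function is linear. Induction along a basis takes the place of Zorn's lemma. *)
Lemma sublinear_scalar_minorant p : sublinear p ->
  exists2 f, scalar f & forall x, f x <= p x.
Proof.
move=> p_sub.
have [q [q_sub qp qb]] := sublinear_minorant_odd (vbasis {:V}) p_sub.
have [qD qZ] := q_sub; have q0 := sublinear0 q_sub.
have q_pos x : 0 <= q x + q (- x) by have := qD x (- x); rewrite subrr q0.
have qZN t x : q (- x) <= - q x -> q (- (t *: x)) <= - q (t *: x).
  move=> qx; case: (lerP 0 t) => [t0|t0].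
    by rewrite -scalerN !qZ// -mulrN ler_wpM2l.
  rewrite -[in leRHS](opprK t) (scaleNr (- t)) -scalerN -scaleNr.
  have Nt0 : 0 <= - t by lra.
  by rewrite !qZ// -mulrN ler_wpM2l//; lra.
have qN x : q (- x) = - q x.
  suff : q (- x) <= - q x by have := q_pos x; lra.
  rewrite (coord_vbasis (memvf x)).
  apply: (big_ind (fun u => q (- u) <= - q u)) => [|u v qu qv|i _].
  - by rewrite oppr0 q0 oppr0.
  - by rewrite opprD; have := qD u v; have := qD (- u) (- v); lra.
  - by apply/qZN/qb/mem_nth; rewrite size_tuple.
exists q => // t x y.
(* Subadditivity at [- u] and [- v], read through oddness, is superadditivity at [u] and [v]. *)
have qDE u v : q (u + v) = q u + q v.
  by have := qD (- u) (- v); have := qD u v; rewrite -opprD !qN; lra.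
rewrite qDE; congr (_ + _); case: (lerP 0 t) => [t0|t0]; first exact: qZ.
have Nt0 : 0 <= - t by lra.
by apply: oppr_inj; rewrite -qN -scaleNr qZ// mulNr.
Qed.

Lemma sublinear_annihilator p (S : set V) : sublinear p ->
  S 0 -> (forall x y, S x -> S y -> S (x + y)) ->
  (forall t x, S x -> S (t *: x)) ->
  (forall x, S x -> 0 <= p x) ->
  exists f, [/\ scalar f, (forall x, f x <= p x) & forall x, S x -> f x = 0].
Proof.
move=> p_sub S0 SD SZ Sp.
(* Minorizing the infimum of [p] over the cosets of [S] forces [f] to vanish  *)
(* on [S].                                                                    *)
have [||||q [q_sub qp qS]] :=
  @sublinear_inf _ p (fun x b => S x /\ b = 0) p_sub.
- by [].
- by move=> x y _ _ [Sx ->] [Sy ->]; rewrite addr0; split=> //; exact: SD.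
- by move=> t x _ _ [Sx ->]; rewrite mulr0; split=> //; exact: SZ.
- by move=> x _ [Sx ->]; exact: Sp.
have [f f_lin fq] := sublinear_scalar_minorant q_sub.
have fS x : S x -> f (- x) <= 0.
  by move=> Sx; rewrite (le_trans (fq _))// -oppr0; apply: qS.
have fN x : f (- x) = - f x.
  have := f_lin (-1) 0 0; rewrite scaler0 addr0 => f0.
  by have := f_lin (-1) x 0; rewrite addr0 scaleN1r; lra.
exists f; split=> // [x|x Sx]; first exact: le_trans (fq x) (qp x).
have := fS _ Sx; have := fS _ (SZ (-1) _ Sx).
by rewrite scaleN1r !fN; lra.
Qed.

End FiniteDimension.
End HahnBanach.

(** * Clarke derivatives and sublinearity under regularity *)

Section ClarkeDerivative.
Context {R : realType} {V : euclideanJordanAlgebraType R}.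
Implicit Types (f : V -> R) (x d : V).

(** The limsup is an infimum, over the sets of the filter, of suprema; a strict bound on it is
    attained by the supremum over one such set. *)
Lemma clarke_derivative_lt f x d (m : R) : (clarke_derivative f x d < m%:E)%E ->
  \forall z \near filter_prod (nbhs x) 0^'+,
    (f (z.1 + z.2 *: d) - f z.1) / z.2 <= m.
Proof.
rewrite /clarke_derivative limf_esupE => /ereal_inf_ltP[_ [W FW <-] supW].
apply: filterS FW => z Wz; rewrite -lee_fin (le_trans _ (ltW supW))//.
by apply: ereal_sup_ubound; exists z.
Qed.

Lemma regular_derivative_sublinear f x (p : V -> R) :
  (forall d, (f (x + t *: d) - f x) / t @[t --> 0^'+] --> p d) ->
  (forall d, (p d)%:E = clarke_derivative f x d) -> sublinear p.
Proof.
move=> p_cvg pE; split=> [d h|s d].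
  (* The increment along [t *: h] is taken from [x + t *: d], which tends to  *)
  (* [x], so the Clarke derivative bounds it.                                 *)
  apply/ler_addgt0Pr => e e0.
  have : (clarke_derivative f x h < (p h + e)%:E)%E.
    by rewrite -pE lte_fin ltrDl.
  move=> /clarke_derivative_lt h_near.
  have {}h_near : \forall t \near 0^'+,
      (f (x + t *: d + t *: h) - f (x + t *: d)) / t <= p h + e.
    have xt : x + t *: d @[t --> (0 : R)^'+] --> x.
      apply: cvg_at_right_filter; rewrite -[X in _ --> X]addr0 -(scale0r d).
      by apply: cvgD; [exact: cvg_cst|apply: cvgZr_tmp; exact: cvg_id].
    case: h_near => -[A B] /= [/xt Ax B0] AB.
    by near=> t; apply: (AB (x + t *: d, t)); split=> /=; near: t.
  have sum_cvg : p h + e + (f (x + t *: d) - f x) / t @[t --> 0^'+] -->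
      p h + e + p d by apply: cvgD; [exact: cvg_cst|exact: p_cvg].
  have : p (d + h) <= p h + e + p d.
    apply: (ler_cvg_to (p_cvg (d + h)) sum_cvg).
    apply: filterS h_near => t; rewrite scalerDr addrA; lra.
  lra.
rewrite le_eqVlt => /predU1P[<-|s0].
  rewrite scale0r mul0r; apply: (cvg_unique _ (p_cvg 0)) => //.
  have -> : (fun t : R => (f (x + t *: 0) - f x) / t) = fun=> 0.
    by apply/funext => t; rewrite scaler0 addr0 subrr mul0r.
  exact: cvg_cst.
apply: (cvg_unique _ (p_cvg (s *: d))) => //.
(* Positive homogeneity is the change of variable from [t] to [t * s], which preserves right
   neighborhoods of 0 as [0 < s]. *)
have s_cvg : t * s @[t --> (0 : R)^'+] --> (0 : R)^'+.
  have ts0 : t * s @[t --> (0 : R)^'+] --> (0 : R).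
    rewrite -[X in _ --> X](mul0r s); apply: cvgMr_tmp.
    by apply: cvg_at_right_filter; exact: cvg_id.
  move=> A /ts0 A_near.
  suff : \forall t \near (0 : R)^'+, A (t * s) by [].
  near=> t; have : 0 < t * s by apply: mulr_gt0.
  by near: t; exact: A_near.
apply: (@cvg_trans _
  (s * ((f (x + t * s *: d) - f x) / (t * s)) @[t --> 0^'+])).
  apply: near_eq_cvg; near=> t; have t0 : 0 < t by [].
  by rewrite scalerA; field; rewrite !gt_eqF.
by apply: cvgMl_tmp; exact: (cvg_comp _ _ s_cvg (p_cvg d)).
Unshelve. all: by end_near. Qed.

End ClarkeDerivative.

(** * First-order condition along orbits, and operator commutation *)

Section Minimizer.
Context {R : realType} {V : euclideanJordanAlgebraType R}.

Lemma locally_lipschitz_atP (f : V -> R) (x : V) : locally_lipschitz_at f x ->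
  exists2 L, 0 < L & exists2 U, nbhs x U &
    forall y z, U y -> U z -> `|f y - f z| <= L * `|y - z|.
Proof.
move=> [U Ux /pinfty_ex_gt0[L L0 fL]]; exists L => //; exists U => // y z Uy Uz.
exact: (fL (y, z)).
Qed.

(** Minimality gives [f a <= f (X a)], since [F] takes the same value at [a] and [X a]. As [X a] is
    within [K * t ^+ 2 * |a|] of [a + t *: D a], the Lipschitz bound keeps the difference quotient
    above [- (L * K * |a|) * t], which tends to 0. *)
Lemma minimizer_derivative_ge0 (f F : V -> R) (E : set V) (a : V)
    (D : V -> V) (l : R) :
  weakly_spectral_fun F -> weakly_spectral_set E -> locally_lipschitz_at f a ->
  local_minimizer E (fun x => f x + F x) a -> derivation D ->
  (f (a + t *: D a) - f a) / t @[t --> 0^'+] --> l -> 0 <= l.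
Proof.
move=> FX EX /locally_lipschitz_atP[L L0 [U Ua fL]] [Ea a_min] D_der l_cvg.
have [K K0 flow] := derivation_flow D_der.
have [e /= e0 Be] : nbhs_ball a (U `&` [set x | E x -> f a + F a <= f x + F x]).
  by apply/nbhs_ballP; apply: filterI.
have cvg0 (c : R) : c * t @[t --> (0 : R)^'+] --> (0 : R).
  rewrite -[X in _ --> X](mulr0 c); apply: cvgMl_tmp.
  by apply: cvg_at_right_filter; exact: cvg_id.
apply: (ler_cvg_to (cvg0 (- (L * K * `|a|))) l_cvg).
near=> t; have t0 : 0 < t by [].
have [X X_aut XD] : exists2 X : {linear V -> V}, jordan_aut X &
  forall x, `|X x - (x + t *: D x)| <= K * t ^+ 2 * `|x| by near: t.
(* Two displacements below [e / 2] put both [a + t *: D a] and [X a] in the ball of radius [e];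
   [t <= 1] makes the quadratic error at most linear in [t]. *)
have t1 : t <= 1 by near: t; exact: nbhs_right_le.
have tDa : `|D a| * t < e / 2.
  near: t; apply: (cvgr_lt _ (cvg0 _)); rewrite divr_gt0//.
have tKa : K * `|a| * t < e / 2.
  near: t; apply: (cvgr_lt _ (cvg0 _)); rewrite divr_gt0//.
have Ue x : `|x - a| < e -> U x /\ (E x -> f a + F a <= f x + F x).
  by move=> xe; apply: Be; rewrite /= -ball_normE /= distrC.
have /Ue[Ut _] : `|a + t *: D a - a| < e.
  by rewrite addrAC subrr add0r normrZ gtr0_norm// mulrC; lra.
have Xa := XD a.
have /Ue[UX aX] : `|X a - a| < e.
  have : `|X a - a| <= `|X a - (a + t *: D a)| + `|D a| * t.
    have -> : X a - a = X a - (a + t *: D a) + t *: D a.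
      by rewrite opprD addrA subrK.
    by rewrite (le_trans (ler_normD _ _))// normrZ gtr0_norm// (mulrC t).
  have : K * t ^+ 2 * `|a| <= K * `|a| * t.
    rewrite mulrAC ler_wpM2l ?mulr_ge0// expr2.
    by rewrite ler_piMl// ltW.
  lra.
have {}aX : f a <= f (X a).
  by have := aX (EX _ Ea _ X_aut); rewrite (FX a _ X_aut) lerD2r.
rewrite ler_pdivlMr//.
have := fL _ _ UX Ut; rewrite ler_norml => /andP[_].
have := ler_wpM2l (ltW L0) Xa.
rewrite expr2; nra.
Unshelve. all: by end_near. Qed.

(** Associativity of [inner] rewrites the pairings of [v] with [jmul u (jmul w a)] and
    [jmul w (jmul u a)] as those of [w] with [jmul a (jmul v u)] and [jmul v (jmul a u)]. *)
Lemma operator_commute_inner (a v : V) :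
  (forall u w, inner v (inner_derivation u w a) = 0 :> R) ->
  operator_commute a v.
Proof.
move=> v0; apply/funext => u; apply: inner_inj => w; rewrite /= /Lop.
have := v0 u w; rewrite /inner_derivation innerBr => /subr0_eq.
rewrite inner_jmul (jmulC v u) inner_jmul (jmulC a w) => ->.
by rewrite (jmulC v) inner_jmul (jmulC (jmul a u)) (jmulC a).
Qed.

End Minimizer.

Theorem corollary1 (R : realType) (V : euclideanJordanAlgebraType R)
    (Theta F : V -> R) (E : set V) (a : V) :
  weakly_spectral_fun F ->
  weakly_spectral_set E ->
  clarke_regular Theta a ->
  local_minimizer E (fun x => Theta x + F x) a ->
  exists2 v : V, clarke_subdifferential Theta a v & operator_commute a v.
Proof.
move=> FX EX [lip_Theta reg_Theta] a_min.
(* Regularity makes the single function [p] both the one-sided derivative, which minimality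
   controls, and the Clarke derivative, which defines the subdifferential. *)
have /choice[p pP] : forall d : V, exists l : R,
    ((Theta (a + t *: d) - Theta a) / t @[t --> 0^'+] --> l) /\
    l%:E = clarke_derivative Theta a d.
  by move=> d; have [l l_cvg lE] := reg_Theta d; exists l.
have p_cvg d := proj1 (pP d); have pE d := proj2 (pP d).
pose S := [set D a | D in @derivation R V].
have [||||f [f_lin fp fS]] :=
  @sublinear_annihilator R V p S (regular_derivative_sublinear p_cvg pE).
- exists (fun=> 0) => //; split=> [k x y|x y]; first by rewrite scaler0 addr0.
  by rewrite linear0l linear0r addr0.
- move=> _ _ [D1 [D1l D1j] <-] [D2 [D2l D2j] <-].
  exists (fun x => D1 x + D2 x) => //; split=> [k x y|x y].
    by rewrite D1l D2l scalerDr addrACA.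
  by rewrite D1j D2j jmulDl jmulDr addrACA.
- move=> t _ [D [Dl Dj] <-]; exists (fun x => t *: D x) => //.
  split=> [k x y|x y]; first by rewrite Dl scalerDr !scalerA mulrC.
  by rewrite Dj scalerDr jmulZl jmulZr.
- move=> _ [D D_der <-].
  exact: minimizer_derivative_ge0 FX EX lip_Theta a_min D_der (p_cvg _).
(* The bound [f <= p] is the subgradient inequality for the vector representing [f]. *)
have [v fE] := riesz f_lin; exists v => [d|].
  by rewrite -pE lee_fin -fE.
apply: operator_commute_inner => u w; rewrite -fE; apply: fS.
by exists (inner_derivation u w) => //; exact: inner_derivationP.
Qed.
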